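(* Let $F$ be a supertropical semifield and let $A\in\mathrm{Mat}_n(F)$ be nonsingular. Then $\overline{\mathrm{SLS}}_{A;n}=\{B\in\overline{\mathrm{SLS}}_n(F):\mathcal I_AB=B\mathcal I_A=B\}$ is a sub-semigroup of $\overline{\mathrm{SLS}}_n(F)$ with left unit element $\mathcal I^\ell_A$ and right unit element $\mathcal I^r_A$, in the sense that $\mathcal I^\ell_AB=B$ and $B\,\mathcal I^r_A=B$ for all $B\in\overline{\mathrm{SLS}}_{A;n}$.
   Context: A supertropical semifield is a semiring $F$ (with zero $\mathbf 0$ and unit $\mathbf 1$) with a multiplicative submonoid $\mathcal T\subset F$ (tangible elements) that is an abelian group, a set $\mathcal G$ (ghost elements) such that $\mathcal G_0:=\mathcal G\cup\{\mathbf 0\}$ is an ordered semiring ideal of $F$, with $F=\mathcal T\cup\mathcal G_0$ (disjoint union), and a map $\nu:F\to\mathcal G_0$ with $\nu^2=\nu$, $\nu(ab)=\nu(a)b=a\nu(b)=\nu(a)\nu(b)$, $\nu(\mathcal T)=\mathcal G$, and $a+b=a$ if $\nu(a)>\nu(b)$, $a+b=\nu(a)$ if $\nu(a)=\nu(b)$. The ghost surpassing relation: $a\models b$ means $a=b+g$ for some $g\in\mathcal G_0$. The tropical determinant of $A=(a_{i,j})\in\mathrm{Mat}_n(F)$ is $\det(A)=\sum_{\pi\in S_n}\prod_{i=1}^n a_{i,\pi(i)}$ (no signs); $A$ is nonsingular if $\det(A)\in\mathcal T$. $\overline{\mathrm{SLS}}_n(F)=\{A\in\mathrm{Mat}_n(F):\det(A)\models\mathbf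 1\}$. The adjoint $\mathrm{adj}(A)$ has $(i,j)$ entry $\det(A_{j,i})$, where $A_{j,i}$ is $A$ with row $j$ and column $i$ deleted. For $A$ nonsingular, $A^\nabla:=\det(A)^{-1}\mathrm{adj}(A)$, $\mathcal I^\ell_A:=AA^\nabla$, $\mathcal I^r_A:=A^\nabla A$, and $\mathcal I_A:=\mathcal I^\ell_A\mathcal I^r_A\mathcal I^\ell_A$. *)

(* Defs.v *)
From HB Require Import structures.
From mathcomp Require Import all_boot all_order all_algebra all_fingroup.

Set Implicit Arguments.
Unset Strict Implicit.
Unset Printing Implicit Defensive.

Import GRing.Theory.
Local Open Scope ring_scope.

Definition adjoin0 (F : pzSemiRingType) (G : {pred F}) : {pred F} :=
  [pred x | (x == 0) || (x \in G)].

(* [tangible], [ghost] and [nu] are T, G and the ghost map. Two of the data are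
   total functions that only matter on part of F: [ghost_le] is the order of
   G_0 = G with 0 adjoined, and [tinv] the inversion of the group T; their
   values elsewhere are unspecified. *)
HB.mixin Record PzSemiRing_isSupertropical F of GRing.PzSemiRing F := {
  tangible : {pred F};
  ghost : {pred F};
  ghost_le : rel F;
  nu : F -> F;
  tinv : F -> F;

  tangible_mulr_closed : mulr_closed tangible;
  tangible_mulC : {in tangible &, commutative *%R};
  tangible_tinv : {in tangible, forall a, tinv a \in tangible};
  tangible_mulVr : {in tangible, forall a, tinv a * a = 1};

  ghost0_addr_closed : addr_closed (adjoin0 ghost);
  ghost0_mull : forall a, {in adjoin0 ghost, forall g, a * g \in adjoin0 ghost};
  ghost0_mulr : forall a, {in adjoin0 ghost, forall g, g * a \in adjoin0 ghost};

  ghost_le_anti : {in adjoin0 ghost &, antisymmetric ghost_le};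
  ghost_le_trans : {in adjoin0 ghost & &, transitive ghost_le};
  ghost_le_total : {in adjoin0 ghost &, total ghost_le};
  ghost_leD : {in adjoin0 ghost & &, forall a b c,
    ghost_le a b -> ghost_le (a + c) (b + c)};
  ghost_leM : {in adjoin0 ghost & &, forall a b c,
    ghost_le a b -> ghost_le (a * c) (b * c)};

  tangible_or_ghost0 : forall a, (a \in tangible) = (a \notin adjoin0 ghost);

  nu_ghost0 : forall a, nu a \in adjoin0 ghost;
  nu_idem : forall a, nu (nu a) = nu a;
  nuMl : forall a b, nu (a * b) = nu a * b;
  nuMr : forall a b, nu (a * b) = a * nu b;
  nuM : forall a b, nu (a * b) = nu a * nu b;
  nu_tangible : forall g, g \in ghost <-> exists2 t, t \in tangible & nu t = g;

  addr_dominant : forall a b,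
    ghost_le (nu b) (nu a) -> nu a != nu b -> a + b = a;
  addr_nu_eq : forall a b, nu a = nu b -> a + b = nu a
}.

#[short(type="supertropicalSemifieldType")]
HB.structure Definition SupertropicalSemifield :=
  {F of GRing.PzSemiRing F & PzSemiRing_isSupertropical F}.

Definition ghost0 (F : supertropicalSemifieldType) : {pred F} :=
  adjoin0 (@ghost F).

Definition ghost_surpasses (F : supertropicalSemifieldType) (a b : F) : Prop :=
  exists2 g : F, g \in @ghost0 F & a = b + g.

(* Unlike the library's [\det], no sign enters. *)
Definition trop_det (F : pzSemiRingType) n (A : 'M[F]_n) : F :=
  \sum_(s : 'S_n) \prod_(i < n) A i (s i).

Definition trop_adj (F : pzSemiRingType) n (A : 'M[F]_n) : 'M[F]_n :=
  \matrix_(i, j) trop_det (row' j (col' i A)).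

Definition sub_semigroup (F : pzSemiRingType) n (S T : 'M[F]_n -> Prop) : Prop :=
  [/\ forall B C, T B -> T C -> T (B *m C),
      forall B, S B -> T B
    & forall B C, S B -> S C -> S (B *m C)].

Section Supertropical.
Variables (F : supertropicalSemifieldType) (n : nat).
Implicit Types A B : 'M[F]_n.

Definition nonsingular A : bool := trop_det A \in @tangible F.

Definition SLSbar A : Prop := ghost_surpasses (trop_det A) 1.

(* The next definitions are meaningful for nonsingular A only, as they involve
   the inverse of [trop_det A] in the group of tangible elements. *)
Definition nabla A : 'M[F]_n := tinv (trop_det A) *: trop_adj A.

Definition quasi_id_l A : 'M[F]_n := A *m nabla A.

Definition quasi_id_r A : 'M[F]_n := nabla A *m A.

Definition quasi_id A : 'M[F]_n := quasi_id_l A *m quasi_id_r A *m quasi_id_l A.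

Definition SLSbar_at A B : Prop :=
  [/\ SLSbar B, quasi_id A *m B = B & B *m quasi_id A = B].

End Supertropical.

(* Main.v *)
Require Import Defs.
From HB Require Import structures.
From mathcomp Require Import all_boot all_order all_algebra all_fingroup.

Set Implicit Arguments.
Unset Strict Implicit.
Unset Printing Implicit Defensive.

Import GRing.Theory.
Local Open Scope ring_scope.

(** The tropical determinant is a permanent, and over a commutative semiring a
    permanent behaves like a determinant up to elements of the form [x + x]:
    where a signed sum would cancel a term against its opposite, the unsigned
    sum has that term twice. Hence a matrix with two equal rows has a doubled
    determinant ([trop_det_eq_rows]). Both classical consequences of alternation
    survive with a doubled error term: the determinant is multiplicative
    ([trop_detM]), and [A *m trop_adj A] has [trop_det A] on its diagonal and
    doubled entries off it ([mulmx_trop_adj_diag], [mulmx_trop_adj_offdiag]).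

    In a supertropical semifield multiplication is commutative and [x + x] is
    the ghost [nu x], so doubled elements are ghosts and are additively
    idempotent. Multiplicativity therefore makes the set of matrices whose
    determinant ghost-surpasses 1 closed under product, while for [A]
    nonsingular the two quasi-identities of [A] are [1 + P] and [1 + R] with
    [P + P = P] and [R + R = R].

    Expanding the product [(1 + P) (1 + R) (1 + P)] exhibits [P] and [R] as
    summands: it equals [1 + P + W] and also [1 + R + W'] for suitable [W] and
    [W']. If it fixes [B] from the left, then [B = B + P B + W B]; adding
    [P B], which is idempotent, to this right-hand side changes nothing, so
    [B + P B = B], that is [(1 + P) B = B]. The same argument on the right,
    with [R], gives [B (1 + R) = B]. *)

(** * Permanents over a commutative semiring *)

Definition is_double (V : nmodType) (x : V) : Prop := exists y, x = y + y.

Lemma is_double_sum (V : nmodType) (I : finType) (P : pred I) (f : I -> V) :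
  (forall i, P i -> is_double (f i)) -> is_double (\sum_(i | P i) f i).
Proof.
move=> fP; apply: big_ind => //; first by exists 0; rewrite addr0.
by move=> _ _ [x ->] [y ->]; exists (x + y); rewrite addrACA.
Qed.

Lemma is_double_mull (R : pzSemiRingType) (a x : R) :
  is_double x -> is_double (a * x).
Proof. by case=> y ->; exists (a * y); rewrite mulrDr. Qed.

Section Permanent.
Variable R : comPzSemiRingType.

Lemma trop_det_tr n (A : 'M[R]_n) : trop_det A^T = trop_det A.
Proof.
rewrite /trop_det (reindex_inj invg_inj) /=; apply: eq_bigr => s _.
rewrite (reindex_inj (@perm_inj _ s)) /=.
by apply: eq_bigr => i _; rewrite mxE permK.
Qed.

Lemma trop_det_row_perm n (s : 'S_n) (A : 'M[R]_n) :
  trop_det (row_perm s A) = trop_det A.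
Proof.
rewrite /trop_det (reindex_inj (mulgI s)) /=; apply: eq_bigr => t _.
rewrite [RHS](reindex_inj (@perm_inj _ s)) /=.
by apply: eq_bigr => i _; rewrite mxE permM.
Qed.

(** Swapping the two equal rows pairs each permutation [s] with a different one
    contributing the same product; the condition [s i < s k] selects one
    member of each pair. *)
Lemma trop_det_eq_rows n (A : 'M[R]_n) i k :
  i != k -> row i A = row k A -> is_double (trop_det A).
Proof.
move=> neq_ik eqA.
exists (\sum_(s : 'S_n | (s i < s k)%N) \prod_(a < n) A a (s a)).
rewrite /trop_det (bigID (fun s : 'S_n => (s i < s k)%N)) /=; congr (_ + _).
rewrite (reindex_inj (mulgI (tperm i k))) /=; apply: eq_big => [s|s _].
  rewrite !permM tpermL tpermR -leqNgt ltn_neqAle.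
  by rewrite (inj_eq val_inj) (inj_eq perm_inj) neq_ik.
rewrite (reindex_inj (@perm_inj _ (tperm i k))); apply: eq_bigr => a _.
rewrite permM tpermK; case: tpermP => [->|->|//].
  by move/rowP/(_ (s i)): eqA; rewrite !mxE.
by move/rowP/(_ (s k)): eqA; rewrite !mxE.
Qed.

(** Expanding the product of sums gives one term for each map from rows to rows.
    The bijective maps yield the product of the determinants; any other map
    repeats a row of [C]. *)
Lemma trop_detM n (B C : 'M[R]_n) :
  exists2 g, is_double g & trop_det (B *m C) = trop_det B * trop_det C + g.
Proof.
pose T (f : {ffun 'I_n -> 'I_n}) :=
  (\prod_i B i (f i)) * trop_det (rowsub f C).
exists (\sum_(f : {ffun 'I_n -> 'I_n} | ~~ injectiveb f) T f).
  apply: is_double_sum => f /injectivePn[i [k neq_ik eq_f]].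
  apply/is_double_mull/(trop_det_eq_rows neq_ik).
  by apply/rowP => j; rewrite !mxE eq_f.
transitivity (\sum_f T f).
  transitivity (\sum_(s : 'S_n) \sum_(f : {ffun 'I_n -> 'I_n})
                  \prod_i (B i (f i) * C (f i) (s i))).
    apply: eq_bigr => s _; rewrite -(bigA_distr_bigA (fun i j => B i j * C j (s i))) /=.
    by apply: eq_bigr => i _; rewrite mxE.
  rewrite exchange_big /=; apply: eq_bigr => f _.
  rewrite /T /trop_det big_distrr /=; apply: eq_bigr => s _.
  by rewrite big_split /=; congr (_ * _); apply: eq_bigr => i _; rewrite mxE.
rewrite (bigID (fun f : {ffun 'I_n -> 'I_n} => injectiveb f)) /=; congr (_ + _).
rewrite (reindex_onto (@pval _) (insubd (1%g : 'S_n))) => [|f inj_f];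
  last exact: insubdK.
rewrite big_distrl /=; apply: eq_big => [s|s _].
  by rewrite valKd eqxx andbT; apply: (valP s).
rewrite /T; congr (_ * _); first by apply: eq_bigr => i _; rewrite pvalE.
rewrite -[RHS](trop_det_row_perm s); congr trop_det.
by apply/matrixP => i j; rewrite !mxE pvalE.
Qed.

(** Laplace expansion along row [k]. Its combinatorial content is that a
    permutation amounts to the image of [k] and a permutation of the remaining
    indices; injectivity of this correspondence suffices, since
    [n.+1`! = n.+1 * n`!]. *)
Lemma trop_det_expand_row n (A : 'M[R]_n) k :
  trop_det A = \sum_j A k j * trop_det (row' k (col' j A)).
Proof.
case: n A k => [|n] A k; first by case: k.
pose h (p : 'I_n.+1 * 'S_n) := lift_perm k p.1 p.2.
have h_inj : injective h.
  move=> [j s] [j' s'] /permP eq_h.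
  have eq_j : j = j' by have := eq_h k; rewrite /h !lift_perm_id.
  rewrite -{}eq_j in eq_h *; congr (_, _); apply/permP => i.
  by have := eq_h (lift k i); rewrite /h !lift_perm_lift => /lift_inj.
have h_bij : bijective h.
  by apply: (inj_card_bij h_inj); rewrite card_prod !card_Sn card_ord.
rewrite /trop_det (reindex h) /=; last exact: onW_bij.
rewrite -(pair_bigA _ (fun j s => \prod_i A i (lift_perm k j s i))) /=.
apply: eq_bigr => j _; rewrite big_distrr /=; apply: eq_bigr => s _.
rewrite (bigD1_ord k) //= lift_perm_id; congr (_ * _).
by apply: eq_bigr => i _; rewrite !mxE lift_perm_lift.
Qed.

(** The minors along row [k] ignore row [k] itself, so pairing them with row [i]
    is the Laplace expansion of [A] with row [k] overwritten by row [i]. *)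
Lemma mulmx_trop_adjE n (A : 'M[R]_n) i k :
  (A *m trop_adj A) i k =
  trop_det (\matrix_a row (if a == k then i else a) A).
Proof.
rewrite (trop_det_expand_row _ k) mxE; apply: eq_bigr => j _.
rewrite !mxE eqxx; congr (_ * trop_det _).
by apply/matrixP => a b; rewrite !mxE eq_sym (negPf (neq_lift _ _)).
Qed.

Lemma mulmx_trop_adj_diag n (A : 'M[R]_n) i :
  (A *m trop_adj A) i i = trop_det A.
Proof.
rewrite mulmx_trop_adjE; congr trop_det; apply/matrixP => a b.
by rewrite !mxE; case: eqP => [->|].
Qed.

Lemma mulmx_trop_adj_offdiag n (A : 'M[R]_n) i k :
  i != k -> is_double ((A *m trop_adj A) i k).
Proof.
move=> neq_ik; rewrite mulmx_trop_adjE; apply: (trop_det_eq_rows neq_ik).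
by apply/rowP => j; rewrite !mxE eqxx (negPf neq_ik).
Qed.

Lemma trop_adj_tr n (A : 'M[R]_n) : trop_adj A^T = (trop_adj A)^T.
Proof.
apply/matrixP => i j; rewrite !mxE -tr_row' -tr_col' trop_det_tr.
by congr trop_det; apply/matrixP => a b; rewrite !mxE.
Qed.

End Permanent.

(** * Absorption of idempotent summands *)

(** Writing the first [x] of [x + p] as [x + p + w] puts two copies of [p] in one
    sum, where idempotence merges them. *)
Lemma absorb_idem (V : nmodType) (x p w : V) :
  p + p = p -> x + p + w = x -> x + p = x.
Proof. by move=> pp xE; rewrite -{1}xE addrAC -(addrA x) pp. Qed.

Section Sandwich.
Variables (M : pzSemiRingType) (p r : M).

Lemma sandwich_fixed_left b :
  p + p = p -> (1 + p) * (1 + r) * (1 + p) * b = b -> (1 + p) * b = b.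
Proof.
move=> pp; have [w ->] : exists w, (1 + p) * (1 + r) * (1 + p) = 1 + p + w.
  exists ((1 + p) * r + (1 + p) * (1 + r) * p).
  by rewrite [LHS]mulrDr mulr1 [X in X + _]mulrDr mulr1 -addrA.
by rewrite !mulrDl mul1r; apply: absorb_idem; rewrite -mulrDl pp.
Qed.

Lemma sandwich_fixed_right b :
  r + r = r -> b * ((1 + p) * (1 + r) * (1 + p)) = b -> b * (1 + r) = b.
Proof.
move=> rr; have [w ->] : exists w, (1 + p) * (1 + r) * (1 + p) = 1 + r + w.
  exists (p * (1 + r) + (1 + p) * (1 + r) * p).
  by rewrite [LHS]mulrDr mulr1 [X in X + _]mulrDl mul1r -addrA.
by rewrite !mulrDr mulr1; apply: absorb_idem; rewrite -mulrDr rr.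
Qed.

End Sandwich.

(** * Supertropical semifields *)

Section Semifield.
Variable F : supertropicalSemifieldType.
Implicit Types a b x : F.

Lemma addrr_nu x : x + x = nu x.
Proof. exact: addr_nu_eq. Qed.

Lemma is_double_ghost0 x : is_double x -> x \in @ghost0 F.
Proof. by case=> y ->; rewrite addrr_nu; apply: nu_ghost0. Qed.

Lemma is_double_idem x : is_double x -> x + x = x.
Proof. by case=> y ->; rewrite !addrr_nu nu_idem. Qed.

Lemma tangible_zero_or_nu a :
  [\/ a \in @tangible F, a = 0 | exists2 t, t \in @tangible F & a = nu t].
Proof.
have [aT|] := boolP (a \in @tangible F); first by constructor 1.
rewrite tangible_or_ghost0 negbK => /orP[/eqP a0|]; first by constructor 2.
by move/nu_tangible => [t tT <-]; constructor 3; exists t.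
Qed.

(** Commutativity is assumed for tangible elements only; every other element is
    0 or [nu t] with [t] tangible, and [nu] moves freely between factors. *)
Lemma supertropical_mulC : commutative (@GRing.mul F).
Proof.
have comm_tangible t b : t \in @tangible F -> t * b = b * t.
  move=> tT; have [bT|->|[u uT ->]] := tangible_zero_or_nu b.
  - exact: tangible_mulC.
  - by rewrite mulr0 mul0r.
  - by rewrite -nuMr -nuMl tangible_mulC.
move=> a b; have [aT|->|[t tT ->]] := tangible_zero_or_nu a.
- exact: comm_tangible.
- by rewrite mulr0 mul0r.
- by rewrite -nuMl -nuMr comm_tangible.
Qed.

(* This makes the results on permanents available for matrices over [F]; the
   instance stays local because it adds commutativity after the fact, beside
   the inheritance graph of the structure. *)
#[local, non_forgetful_inheritance]
HB.instance Definition _ :=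
  GRing.PzSemiRing_hasCommutativeMul.Build F supertropical_mulC.

Section Matrices.
Variable n : nat.
Implicit Types A B C : 'M[F]_n.

Lemma SLSbar_mul B C : SLSbar B -> SLSbar C -> SLSbar (B *m C).
Proof.
move=> [g gG detB] [h hG detC].
have [k /is_double_ghost0 kG detBC] := trop_detM B C.
have ghostD : {in @ghost0 F &, forall x y, x + y \in @ghost0 F}.
  by case: (@ghost0_addr_closed F).
exists (g + (1 + g) * h + k).
  by do 2!apply: (ghostD) => //; apply: ghost0_mull.
by rewrite detBC detB detC mulrDr mulr1 !addrA.
Qed.

(** Off the diagonal the entries are doubled, hence idempotent; on it they are
    exactly 1, which leaves 0 for [P] there. *)
Lemma quasi_id_l_decomp A :
  nonsingular A -> exists2 P : 'M[F]_n, P + P = P & quasi_id_l A = 1 + P.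
Proof.
move=> nsA; have qE : quasi_id_l A = tinv (trop_det A) *: (A *m trop_adj A).
  by rewrite /quasi_id_l /nabla -scalemxAr.
have diag i : quasi_id_l A i i = 1.
  by rewrite qE mxE mulmx_trop_adj_diag; apply: tangible_mulVr.
have offdiag i j : i != j -> is_double (quasi_id_l A i j).
  by move=> neq_ij; rewrite qE mxE; apply/is_double_mull/mulmx_trop_adj_offdiag.
move: (quasi_id_l A) diag offdiag => Q diag offdiag.
exists (\matrix_(i, j) if i == j then 0 else Q i j).
  apply/matrixP => i j; rewrite !mxE; case: eqVneq => [_|/offdiag].
    by rewrite addr0.
  exact: is_double_idem.
apply/matrixP => i j; rewrite !mxE; case: eqVneq => [<-|_].
  by rewrite addr0 diag.
by rewrite add0r.
Qed.

(** Transposition exchanges the two quasi-identities, so the Laplace expansion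
    along rows also governs the right one. *)
Lemma quasi_id_r_tr A : quasi_id_r A = (quasi_id_l A^T)^T.
Proof.
rewrite /quasi_id_l /quasi_id_r /nabla trop_adj_tr trop_det_tr.
by rewrite trmx_mul trmxK linearZ /= trmxK.
Qed.

Lemma quasi_id_r_decomp A :
  nonsingular A -> exists2 R : 'M[F]_n, R + R = R & quasi_id_r A = 1 + R.
Proof.
rewrite /nonsingular -trop_det_tr => /quasi_id_l_decomp[P PP qE].
exists P^T; first by rewrite -raddfD PP.
by rewrite quasi_id_r_tr qE raddfD /= trmx1.
Qed.

End Matrices.
End Semifield.

Theorem lemma3p26 (F : supertropicalSemifieldType) (n : nat) (A : 'M[F]_n) :
  nonsingular A ->
  sub_semigroup (SLSbar_at A) (@SLSbar F n) /\
  (forall B : 'M[F]_n, SLSbar_at A B ->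
     quasi_id_l A *m B = B /\ B *m quasi_id_r A = B).
Proof.
move=> nsA; split.
  split=> [|B []//|B C [slB AB _] [slC _ CA]]; first exact: SLSbar_mul.
  split; first exact: SLSbar_mul.
    by rewrite mulmxA AB.
  by rewrite -mulmxA CA.
have [P PP lE] := quasi_id_l_decomp nsA.
have [R RR rE] := quasi_id_r_decomp nsA.
move=> B [_]; rewrite /quasi_id lE rE => AB BA.
split; first exact: (sandwich_fixed_left PP AB).
exact: (sandwich_fixed_right RR BA).
Qed.
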